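(* Let $k$ be a field with $u(k)\leq 2$ which is not quadratically closed, with $\mathrm{char}(k)\neq 2$ and $|k|\geq 5$. Let $\overline{\epsilon}\in k^{\times}/k^{\times 2}$, and let $\mathscr{C}$ be a semisimple conjugacy class in $\mathrm{SL}_2(k)$. Then the following hold: (1) $\mathscr{C} U_{\overline{\epsilon}}$ contains neither $I$ nor $-I$. (2) $\mathscr{C} U_{\overline{\epsilon}}$ contains $\mathscr{C}$ if and only if $\mathscr{C}$ is split semisimple. (3) $\mathscr{C} U_{\overline{\epsilon}}$ contains $\mathscr{C}'$ for every semisimple conjugacy class $\mathscr{C}'$ with $\mathscr{C}'\neq \mathscr{C}$. (4) For a unipotent conjugacy class $U_{\overline{\epsilon_1}}$, $\mathscr{C} U_{\overline{\epsilon}}$ contains $U_{\overline{\epsilon_1}}$ if and only if $\overline{\mathrm{tr}(\mathscr{C})-2} =\overline{\epsilon \epsilon_1}$ in $k^{\times}/k^{\times 2}$. (5) For a negative unipotent conjugacy class $U_{-1,\overline{\epsilon_1}}$, $\mathscr{C} U_{\overline{\epsilon}}$ contains $U_{-1,\overline{\epsilon_1}}$ if and only if $\overline{\mathrm{tr}(\mathscr{C})+2} =\overline{\epsilon \epsilon_1}$ in $k^{\times}/k^{\times 2}$.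
   Context: A field $k$ has $u(k)\leq 2$ if every quadratic form in $3$ variables over $k$ is isotropic. A field is quadratically closed if it admits no quadratic extension. $k^{\times 2}$ is the set of squares in $k^\times$, and $\bar\epsilon$ is the image of $\epsilon\in k^\times$ in $k^\times/k^{\times2}$. $U_{\overline{\epsilon}}$ denotes the $\mathrm{SL}_2(k)$-conjugacy class of $\begin{pmatrix}1&\epsilon\\0&1\end{pmatrix}$ and $U_{-1,\overline{\epsilon}}$ that of $\begin{pmatrix}-1&\epsilon\\0&-1\end{pmatrix}$; both depend only on $\overline{\epsilon}$. Semisimple classes are non-central; they are split if their elements are diagonalizable over $k$ and non-split otherwise. $\mathrm{tr}(\mathscr{C})$ is the common trace of elements of $\mathscr{C}$. $AB=\{xy:x\in A,y\in B\}$. *)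

(* Defs.v *)
From mathcomp Require Import all_boot all_order all_algebra all_field.
From mathcomp Require Import boolp classical_sets.

Set Implicit Arguments.
Unset Strict Implicit.
Unset Printing Implicit Defensive.

Import GRing.Theory.
Local Open Scope ring_scope.
Local Open Scope classical_set_scope.

(* Every form \sum_(i, j) q_ij x_i x_j is represented (Q is not assumed
   symmetric), and degenerate forms are allowed: they are isotropic anyway. *)
Definition quadratic_form (k : fieldType) (n : nat) (Q : 'M[k]_n)
    (x : 'rV[k]_n) : k :=
  \sum_i \sum_j Q i j * x 0 i * x 0 j.

Definition isotropic (k : fieldType) (n : nat) (q : 'rV[k]_n -> k) : Prop :=
  exists2 x : 'rV[k]_n, x != 0 & q x = 0.

Definition u_le2 (k : fieldType) : Prop :=
  forall Q : 'M[k]_3, isotropic (quadratic_form Q).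

Definition quadratically_closed (k : fieldType) : Prop :=
  ~ exists L : fieldExtType k, \dim {:L} = 2%N.

(* For a != 0, the coset of a in k^x / k^x2, as a subset of k.
   For a = 0 this is [set 0], which differs from every such coset. *)
Definition sqclass (k : fieldType) (a : k) : set k :=
  [set a * c ^+ 2 | c in [set c : k | c != 0]].

Definition SL2 (k : fieldType) : set 'M[k]_2 := [set g | \det g = 1].
Arguments SL2 : clear implicits.

Definition SL2_class (k : fieldType) (g : 'M[k]_2) : set 'M[k]_2 :=
  [set h *m g *m invmx h | h in SL2 k].

Definition SL2_central (k : fieldType) (g : 'M[k]_2) : Prop :=
  forall h : 'M[k]_2, SL2 k h -> g *m h = h *m g.

(* Diagonalizable over some extension of k, equivalently over an algebraic
   closure of k. *)
Definition semisimple (k : fieldType) (g : 'M[k]_2) : Prop :=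
  exists (L : fieldType) (iota : {rmorphism k -> L}),
    diagonalizable (map_mx iota g).

Definition semisimple_class (k : fieldType) (C : set 'M[k]_2) : Prop :=
  exists g : 'M[k]_2,
    [/\ SL2 k g, ~ SL2_central g, semisimple g & C = SL2_class g].

Definition split_semisimple_class (k : fieldType) (C : set 'M[k]_2) : Prop :=
  semisimple_class C /\ forall g : 'M[k]_2, C g -> diagonalizable g.

Definition unipotent_class (k : fieldType) (e : k) : set 'M[k]_2 :=
  SL2_class (1%:M + e *: delta_mx 0 1).

Definition neg_unipotent_class (k : fieldType) (e : k) : set 'M[k]_2 :=
  SL2_class ((-1)%:M + e *: delta_mx 0 1).

Definition class_mul (k : fieldType) (A B : set 'M[k]_2) : set 'M[k]_2 :=
  [set x *m y | x in A & y in B].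

(* The trace is constant on a conjugacy class (class_traceE), so the choice
   of an element of its image is immaterial. *)
Definition class_trace (k : fieldType) (C : set 'M[k]_2) : k :=
  xget 0 [set \tr g | g in C].

Lemma SL2_unitmx (k : fieldType) (h : 'M[k]_2) : SL2 k h -> h \in unitmx.
Proof. by rewrite /SL2 /= unitmxE => ->; exact: unitr1. Qed.

Lemma class_traceE (k : fieldType) (g : 'M[k]_2) :
  class_trace (SL2_class g) = \tr g.
Proof.
rewrite /class_trace; case: xgetP => [t _ [_ [h hS <-] <-] | /(_ (\tr g)) []].
  by rewrite mxtrace_mulC mulmxA mulVmx ?mul1mx ?SL2_unitmx.
exists g => //; exists 1%:M; first by rewrite /SL2 /= det1.
by rewrite mul1mx invmx1 mulmx1.
Qed.

Lemma SL2_class_shear_sqr (k : fieldType) (a e c : k) : c != 0 ->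
  SL2_class (a%:M + (e * c ^+ 2) *: delta_mx 0 1)
  = SL2_class (a%:M + e *: delta_mx 0 1) :> set 'M[k]_2.
Proof.
move=> c0.
pose d (x : k) : 'M[k]_2 := diag_mx (\row_j (if j == 0 then x else x^-1)).
have dS (x : k) : x != 0 -> SL2 k (d x).
  by move=> x0; rewrite /SL2 /= det_diag !big_ord_recl big_ord0 !mxE /=
    mulr1 divff.
have dV (x : k) : x != 0 -> d x *m d x^-1 = 1%:M.
  move=> x0; apply/matrixP => i j; rewrite mul_diag_mx !mxE.
  by case: (i == j); rewrite ?mulr0n ?mulr1n ?mulr0 //;
    case: (_ == 0); rewrite ?mulfV ?invr_eq0.
have conj (x f : k) : x != 0 -> d x *m (a%:M + f *: delta_mx 0 1) *m d x^-1
    = a%:M + (f * x ^+ 2) *: delta_mx 0 1.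
  move=> x0; rewrite mulmxDr mulmxDl; congr (_ + _).
    by rewrite scalar_mxC -mulmxA dV // mulmx1.
  rewrite mul_diag_mx mul_mx_diag; apply/matrixP => i j.
  rewrite !mxE; case: i j => [[|[|//]] ?] [[|[|//]] ?];
    by rewrite /= ?(mulr0, mul0r, mulr1) // invrK expr2 mulrCA mulrA.
have sub (x f : k) : x != 0 -> SL2_class (a%:M + (f * x ^+ 2) *: delta_mx 0 1)
    `<=` SL2_class (a%:M + f *: delta_mx 0 1).
  move=> x0 _ [h hS <-]; exists (h *m d x).
    by rewrite /SL2 /= det_mulmx hS (dS _ x0) mulr1.
  have dinv : invmx (d x) = d x^-1.
    by rewrite -[LHS]mulmx1 -(dV _ x0) mulmxA mulVmx ?mul1mx // SL2_unitmx //;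
       exact: dS.
  have -> : invmx (h *m d x) = d x^-1 *m invmx h.
    have hu := SL2_unitmx hS; have du := SL2_unitmx (dS _ x0).
    have hdu : h *m d x \in unitmx by rewrite unitmx_mul hu du.
    apply: (can_inj (mulKmx hdu)); rewrite mulmxV //.
    by rewrite mulmxA -(mulmxA h) dV // mulmx1 mulmxV.
  by rewrite -(conj _ _ x0) !mulmxA.
apply/seteqP; split; first exact: sub.
rewrite -[X in X *: _](mulfK (expf_neq0 2 c0)) -exprVn.
by apply: sub; rewrite invr_eq0.
Qed.

(* U_eps and U_{-1, eps} depend only on the square class of eps. *)
Lemma unipotent_class_sqclass (k : fieldType) (e f : k) :
  sqclass e = sqclass f -> unipotent_class e = unipotent_class f.
Proof.
move=> ef; have : sqclass f e.
  by rewrite -ef; exists 1; rewrite /= ?oner_neq0 // expr1n mulr1.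
by case=> c /= c0 <-; exact: SL2_class_shear_sqr.
Qed.

Lemma neg_unipotent_class_sqclass (k : fieldType) (e f : k) :
  sqclass e = sqclass f -> neg_unipotent_class e = neg_unipotent_class f.
Proof.
move=> ef; have : sqclass f e.
  by rewrite -ef; exists 1; rewrite /= ?oner_neq0 // expr1n mulr1.
by case=> c /= c0 <-; exact: SL2_class_shear_sqr.
Qed.

(* Main.v *)
(* If t = tr A with A in SL_2(k) and t^2 <> 4, the binary form
   v |-> det (v, A v) is nondegenerate, hence represents 1 because u(k) <= 2, and
   A is SL_2(k)-conjugate to the companion matrix of X^2 - t X + 1. So a
   semisimple class is the set of all matrices of determinant 1 with a given
   trace t, and t^2 <> 4.
   Up to conjugation the factor in U_eps is u = 1 + eps E_01, and A u has the
   same lower left entry c as A and trace tr A + eps c. Thus A u has trace t'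
   exactly when c = (t' - t) / eps, and such an A exists unless c = 0 and the
   class is non-split. When t' = 2 s with s = 1 or -1, A u is conjugate to
   s + eps1 E_01 if and only if -c lies in the square class of eps1. *)
Require Import Defs.
From mathcomp Require Import all_boot all_order all_algebra all_field.
From mathcomp Require Import boolp classical_sets.
From mathcomp Require Import ring.

Set Implicit Arguments.
Unset Strict Implicit.
Unset Printing Implicit Defensive.

Import GRing.Theory.
Local Open Scope ring_scope.
Local Open Scope classical_set_scope.

(** * Two-by-two matrices written by their entries *)

Definition mx2 (R : Type) (a b c d : R) : 'M[R]_2 :=
  \matrix_(i, j) (if i == 0 then if j == 0 then a else b
                  else if j == 0 then c else d).

Lemma mx2_eta (R : Type) (A : 'M[R]_2) :
  A = mx2 (A 0 0) (A 0 1) (A 1 0) (A 1 1).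
Proof.
apply/matrixP => i j; rewrite mxE.
by case: i j => [[|[|//]] ?] [[|[|//]] ?]; congr (A _ _); apply/val_inj.
Qed.

Lemma mx2_inj (R : Type) (a b c d a' b' c' d' : R) :
  mx2 a b c d = mx2 a' b' c' d' -> [/\ a = a', b = b', c = c' & d = d'].
Proof.
move=> e; split; [have := congr1 (fun A : 'M_2 => A 0 0) e|
  have := congr1 (fun A : 'M_2 => A 0 1) e|
  have := congr1 (fun A : 'M_2 => A 1 0) e|
  have := congr1 (fun A : 'M_2 => A 1 1) e]; by rewrite !mxE.
Qed.

Lemma det_mx2 (R : comNzRingType) (a b c d : R) :
  \det (mx2 a b c d) = a * d - b * c.
Proof.
rewrite (expand_det_row _ 0) !big_ord_recl big_ord0 /cofactor !det_mx11 !mxE /=.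
by ring.
Qed.

Lemma mxtrace_mx2 (R : nzRingType) (a b c d : R) : \tr (mx2 a b c d) = a + d.
Proof. by rewrite /mxtrace !big_ord_recl big_ord0 !mxE /= addr0. Qed.

Lemma mul_mx2 (R : nzRingType) (a b c d a' b' c' d' : R) :
  mx2 a b c d *m mx2 a' b' c' d' =
  mx2 (a * a' + b * c') (a * b' + b * d') (c * a' + d * c') (c * b' + d * d').
Proof.
apply/matrixP => i j; rewrite !mxE !big_ord_recl big_ord0 !mxE /= addr0.
by case: i j => [[|[|//]] ?] [[|[|//]] ?].
Qed.

Lemma shear_mx2 (R : nzRingType) (s e : R) :
  s%:M + e *: delta_mx 0 1 = mx2 s e 0 s.
Proof.
apply/matrixP => i j; rewrite !mxE.
by case: i j => [[|[|//]] ?] [[|[|//]] ?];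
  rewrite /= ?mulr1n ?mulr0n ?mulr0 ?mulr1 ?add0r ?addr0.
Qed.

Lemma scalar_mx2 (R : nzRingType) (s : R) : s%:M = mx2 s 0 0 s.
Proof. by rewrite -shear_mx2 scale0r addr0. Qed.

Lemma map_mx2 (R S : Type) (f : R -> S) (a b c d : R) :
  map_mx f (mx2 a b c d) = mx2 (f a) (f b) (f c) (f d).
Proof.
apply/matrixP => i j; rewrite !mxE.
by case: i j => [[|[|//]] ?] [[|[|//]] ?].
Qed.

(** Clearing the inverse leaves an equation of products, from which determinant and trace are read
    off. *)
Lemma diagonalizable_mx2P (F : fieldType) (A : 'M[F]_2) :
  diagonalizable A <->
  exists P x y, P \in unitmx /\ P *m A = mx2 x 0 0 y *m P.
Proof.
have diagE (D : 'rV[F]_2) : diag_mx D = mx2 (D 0 0) 0 0 (D 0 1).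
  rewrite [LHS]mx2_eta !mxE /= ?mulr1n ?mulr0n.
  by congr (mx2 (D _ _) _ _ (D _ _)).
split=> [[P Pu /diagonalizable_forPex [D /(simmxP Pu) e]]|[P [x [y [Pu e]]]]].
  by exists P, (D 0 0), (D 0 1); rewrite -diagE.
exists P => //; apply/diagonalizable_forPex.
exists (\row_j if j == 0 then x else y).
by apply/(simmxP Pu); rewrite diagE !mxE.
Qed.

Lemma unit_conj_det_tr (F : fieldType) n (P A D : 'M[F]_n) :
  P \in unitmx -> P *m A = D *m P -> \det A = \det D /\ \tr A = \tr D.
Proof.
move=> Pu /(congr1 (mulmx (invmx P))); rewrite mulKmx // => ->.
rewrite mxtrace_mulC mulmxK //; split=> //.
by rewrite !det_mulmx mulrCA -det_mulmx mulVmx // det1 mulr1.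
Qed.

(** * Conjugacy in $SL_2(k)$ and its trace invariant *)

Section Field.
Variable k : fieldType.
Implicit Types (A M g h : 'M[k]_2).

Lemma SL2_classP g M :
  SL2_class g M <-> exists2 h, SL2 k h & M *m h = h *m g.
Proof.
split=> [[h hS <-]|[h hS e]]; exists h => //.
  by rewrite mulmxKV // SL2_unitmx.
by rewrite -e mulmxK // SL2_unitmx.
Qed.

Lemma SL2_mul g h : SL2 k g -> SL2 k h -> SL2 k (g *m h).
Proof. by rewrite /SL2 /= det_mulmx => -> ->; rewrite mulr1. Qed.

Lemma SL2_inv h : SL2 k h -> SL2 k (invmx h).
Proof. by rewrite /SL2 /= det_inv => ->; rewrite invr1. Qed.

Lemma SL2_class_refl g : SL2_class g g.
Proof.
by apply/SL2_classP; exists 1%:M; rewrite ?mul1mx ?mulmx1 /SL2 /= ?det1.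
Qed.

Lemma SL2_class_conj g h M : SL2 k h -> SL2_class g M ->
  SL2_class g (h *m M *m invmx h).
Proof.
move=> hS /SL2_classP [p pS e]; apply/SL2_classP; exists (h *m p).
  exact: SL2_mul.
by rewrite -!mulmxA mulKmx ?SL2_unitmx // e.
Qed.

Lemma SL2_class_det_tr g M :
  SL2_class g M -> \det M = \det g /\ \tr M = \tr g.
Proof.
move=> /SL2_classP [h hS e]; have hu := SL2_unitmx hS.
by have [] := unit_conj_det_tr hu (esym e) => -> ->.
Qed.

(** A zero of [a x^2 + b x y + c y^2 - z^2] gives the value 1 after division by [z]. If [z = 0], the
    binary form is isotropic and nondegenerate, hence universal. *)
Lemma binary_form_represents1 (a b c : k) : u_le2 k ->
  b ^+ 2 - 4 * (a * c) != 0 ->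
  exists x y, a * x ^+ 2 + b * (x * y) + c * y ^+ 2 = 1.
Proof.
move=> hu disc.
(* Taking [Q] upper triangular lets [b] enter without being halved. *)
pose Q : 'M[k]_3 := \matrix_(i, j)
  (if (i == 0) && (j == 0) then a else if (i == 0) && (j == 1) then b
   else if (i == 1) && (j == 1) then c else - ((i == 2) && (j == 2))%:R).
have [v vn0] := hu Q.
set x := v 0 0; set y := v 0 1; set z := v 0 (lift 0 (lift 0 0)).
have -> : quadratic_form Q v = a * x ^+ 2 + b * (x * y) + c * y ^+ 2 - z ^+ 2.
  rewrite /quadratic_form !big_ord_recl !big_ord0 !mxE /=.
  have -> : v 0 (lift 0 0) = y by congr (v _ _); apply/val_inj.
  by rewrite -/x -/z; ring.
move=> /eqP; rewrite subr_eq0 => /eqP qv.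
have [z0|zn0] := eqVneq z 0; last first.
  exists (x / z), (y / z); rewrite !exprMn !exprVn.
  transitivity ((a * x ^+ 2 + b * (x * y) + c * y ^+ 2) / z ^+ 2).
    by field.
  by rewrite qv divff // expf_neq0.
(* (x, y) is isotropic: on a line (p, q) + s (x, y) with (p, q) not orthogonal
   to (x, y) the form is a nonconstant affine function of s. *)
rewrite z0 expr0n /= in qv.
have univ p q : (2 * a * x + b * y) * p + (b * x + 2 * c * y) * q != 0 ->
    exists x y, a * x ^+ 2 + b * (x * y) + c * y ^+ 2 = 1.
  set B := _ + _ => B0; pose r := a * p ^+ 2 + b * (p * q) + c * q ^+ 2.
  pose s := (1 - r) / B; exists (s * x + p), (s * y + q).
  transitivity (s ^+ 2 * (a * x ^+ 2 + b * (x * y) + c * y ^+ 2) + s * B + r).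
    by rewrite /B /r; ring.
  by rewrite qv mulr0 add0r /s divfK // subrK.
have [B1|/eqP B1] := eqVneq (2 * a * x + b * y) 0; last first.
  by apply: (univ 1 0); rewrite mulr0 addr0 mulr1; apply/eqP.
have [B2|/eqP B2] := eqVneq (b * x + 2 * c * y) 0; last first.
  by apply: (univ 0 1); rewrite mulr0 add0r mulr1; apply/eqP.
case/eqP: vn0; apply/rowP => i; rewrite mxE.
(* Cramer's rule: [B1] and [B2] are linear equations in [(x, y)] with determinant [4 a c - b^2],
   nonzero by [disc]. *)
have x0 : x = 0.
  apply: (mulfI disc); rewrite mulr0.
  transitivity (b * (b * x + 2 * c * y) - 2 * c * (2 * a * x + b * y)).
    by ring.
  by rewrite B1 B2 !mulr0 subr0.
have y0 : y = 0.
  apply: (mulfI disc); rewrite mulr0.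
  transitivity (b * (2 * a * x + b * y) - 2 * a * (b * x + 2 * c * y)).
    by ring.
  by rewrite B1 B2 !mulr0 subr0.
case: i => [[|[|[|//]]] p];
  [rewrite -[RHS]x0|rewrite -[RHS]y0|rewrite -[RHS]z0];
  by congr (v _ _); apply/val_inj.
Qed.

(* The columns of h are v, A v with det (v, A v) = 1; as a quadratic form in v,
   det (v, A v) has discriminant tr A ^ 2 - 4. *)
Lemma SL2_class_companion A : u_le2 k -> \det A = 1 -> \tr A ^+ 2 != 4 ->
  exists2 h, SL2 k h & A *m h = h *m mx2 0 (-1) 1 (\tr A).
Proof.
move=> hu; rewrite {1 2 3}[A]mx2_eta det_mx2 mxtrace_mx2.
move: (A 0 0) (A 0 1) (A 1 0) (A 1 1) (mx2_eta A) => a b c d -> det1 tr.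
rewrite mxtrace_mx2.
have [|x [y xy]] := @binary_form_represents1 c (d - a) (- b) hu.
  rewrite (_ : _ - _ = (a + d) ^+ 2 - 4); first by rewrite subr_eq0.
  transitivity ((a + d) ^+ 2 - 4 * (a * d - b * c)); first by ring.
  by rewrite det1 mulr1.
exists (mx2 x (a * x + b * y) y (c * x + d * y)).
  by rewrite /SL2 /= det_mx2 -xy; ring.
rewrite !mul_mx2; congr mx2; try ring.
(* The second column is Cayley-Hamilton applied to [v = (x, y)]: [A^2 v = tr(A) A v - det(A) v]. *)
- transitivity (x * (a * d - b * c) * -1 + (a * x + b * y) * (a + d)).
    by ring.
  by rewrite det1 mulr1.
- transitivity (y * (a * d - b * c) * -1 + (c * x + d * y) * (a + d)).
    by ring.
  by rewrite det1 mulr1.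
Qed.

(** The companion matrix depends on the trace alone, so it links any two such matrices. *)
Lemma SL2_class_regular g : u_le2 k -> \det g = 1 -> \tr g ^+ 2 != 4 ->
  SL2_class g = [set A | \det A = 1 /\ \tr A = \tr g].
Proof.
move=> hu g1 gt; apply/seteqP; split=> [A cA|A [/= A1 At]].
  by have [dA tA] := SL2_class_det_tr cA; rewrite /= dA tA.
have [h hS eh] := SL2_class_companion hu g1 gt.
have [p pS ep] : exists2 h, SL2 k h & A *m h = h *m mx2 0 (-1) 1 (\tr g).
  by rewrite -At; apply: SL2_class_companion; rewrite ?At.
have hU := SL2_unitmx hS.
apply/SL2_classP; exists (p *m invmx h).
  by apply: SL2_mul => //; exact: SL2_inv.
rewrite mulmxA ep -!mulmxA; congr (_ *m _).
by apply: (can_inj (mulKmx hU)); rewrite mulKVmx // !mulmxA -eh mulmxK.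
Qed.

(** Eigenvalues [x], [y] in [L] satisfy [x y = 1] and [(x - y)^2 = tr^2 - 4]. If this vanishes, [g]
    is scalar over [L], hence over [k], hence central. *)
Lemma semisimple_noncentral_tr g :
  SL2 k g -> ~ SL2_central g -> semisimple g -> \tr g ^+ 2 != 4.
Proof.
rewrite /SL2 /= => g1 gc [L [f /diagonalizable_mx2P [P [x [y [Pu e]]]]]].
apply/eqP => t4; apply: gc => h _.
have [] := unit_conj_det_tr Pu e.
rewrite det_map_mx g1 rmorph1 trace_map_mx det_mx2 mxtrace_mx2 => xy1 xyt.
have xy : x = y.
  apply/eqP; rewrite -subr_eq0 -sqrf_eq0; apply/eqP.
  transitivity ((x + y) ^+ 2 - 4 * (x * y - 0 * 0)); first by ring.
  by rewrite -xy1 -xyt -rmorphXn t4 rmorph_nat mulr1 subrr.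
move: e; rewrite -xy -scalar_mx2 -scalar_mxC => /(congr1 (mulmx (invmx P))).
rewrite !mulKmx // scalar_mx2 [g]mx2_eta map_mx2 => e.
have [g00 g01 g10 g11] := mx2_inj e.
have -> : g 0 1 = 0 by apply: (fmorph_inj f); rewrite g01 rmorph0.
have -> : g 1 0 = 0 by apply: (fmorph_inj f); rewrite g10 rmorph0.
have -> : g 1 1 = g 0 0 by apply: (fmorph_inj f); rewrite g11 g00.
by rewrite -scalar_mx2 scalar_mxC.
Qed.

(** * Products of conjugacy classes *)

Lemma class_mulP g g' M : class_mul (SL2_class g) (SL2_class g') M <->
  exists h A, [/\ SL2 k h, SL2_class g A & M *m h = h *m (A *m g')].
Proof.
split=> [[A cA [B /SL2_classP [h hS e] <-]]|[h [A [hS cA e]]]].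
  have hu := SL2_unitmx hS.
  exists h, (invmx h *m A *m invmx (invmx h)); split=> //.
    by apply: SL2_class_conj => //; exact: SL2_inv.
  by rewrite invmxK !mulmxA mulmxV // mul1mx -!mulmxA e.
have hu := SL2_unitmx hS.
exists (h *m A *m invmx h); first exact: SL2_class_conj.
exists (h *m g' *m invmx h).
  by apply: SL2_class_conj => //; exact: SL2_class_refl.
by rewrite !mulmxA mulmxKV // -(mulmxA h A) -e mulmxK.
Qed.

(** A product of classes is stable under conjugation, so one element decides, and a further
    conjugation makes the second factor [g'] itself. *)
Lemma sub_class_mulP g g' p :
  SL2_class p `<=` class_mul (SL2_class g) (SL2_class g') <->
  exists2 A, SL2_class g A & SL2_class p (A *m g').
Proof.
split=> [sub|[A cA /SL2_classP [h hS e]] M /SL2_classP [q qS eq]].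
  have /class_mulP [h [A [hS cA e]]] := sub _ (SL2_class_refl p).
  have hu := SL2_unitmx hS.
  exists A => //; apply/SL2_classP; exists (invmx h); first exact: SL2_inv.
  by apply: (can_inj (mulKmx hu)); rewrite mulmxA -e mulmxK // mulKVmx.
have hu := SL2_unitmx hS.
apply/class_mulP; exists (q *m invmx h), A; split=> //.
  by apply: SL2_mul => //; exact: SL2_inv.
rewrite mulmxA eq -!mulmxA; congr (_ *m _).
by apply: (can_inj (mulKmx hu)); rewrite mulKVmx // !mulmxA -e mulmxK.
Qed.

(** * Shears and the lower left entry *)

Lemma mul_shear (e : k) A :
  A *m (1%:M + e *: delta_mx 0 1) =
  mx2 (A 0 0) (e * A 0 0 + A 0 1) (A 1 0) (e * A 1 0 + A 1 1).
Proof.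
by rewrite shear_mx2 [A in LHS]mx2_eta mul_mx2; congr mx2; ring.
Qed.

(** Here [r] is the lower left entry of the conjugating matrix; a nonzero [M 1 0] thus determines
    the square class of [e]. *)
Lemma shear_class_entry (s e : k) M : SL2_class (s%:M + e *: delta_mx 0 1) M ->
  exists r, M 1 0 = - (e * r ^+ 2).
Proof.
move=> [h hS <-]; exists (h 1 0).
have hu := SL2_unitmx hS.
move: hu hS; rewrite /SL2 /= shear_mx2 [h]mx2_eta det_mx2.
move: (h 0 0) (h 0 1) (h 1 0) (h 1 1) => p q r w hu pw.
have -> : invmx (mx2 p q r w) = mx2 w (- q) (- r) p.
  apply: (can_inj (mulKmx hu)); rewrite mulmxV // mul_mx2 scalar_mx2.
  by congr mx2; rewrite -?pw; ring.
by rewrite !mul_mx2 !mxE /=; ring.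
Qed.

Lemma shear_class_mem (s e r : k) M : e != 0 -> r != 0 ->
  \det M = s ^+ 2 -> \tr M = s + s -> M 1 0 = - (e * r ^+ 2) ->
  SL2_class (s%:M + e *: delta_mx 0 1) M.
Proof.
move=> e0 r0; rewrite -(SL2_class_shear_sqr s e r0) shear_mx2.
have : e * r ^+ 2 != 0 by rewrite mulf_neq0 ?expf_neq0.
move: (e * r ^+ 2) => f f0; rewrite {1 2}[M]mx2_eta det_mx2 mxtrace_mx2.
move=> detM trM cM; rewrite [M]mx2_eta cM; rewrite cM in detM.
move: (M 0 0) (M 0 1) (M 1 1) detM trM => a b d detM trM.
have dE : d = s + s - a by rewrite -trM; ring.
have bE : b = (a - s) ^+ 2 / f.
  by apply: (mulIf f0); rewrite divfK //; move: detM; rewrite dE => detM;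
    transitivity (a * (s + s - a) - b * - f - a * (s + s - a));
    [ring|rewrite detM; ring].
(* With [M 1 0 = - f], the first column is an eigenvector of [M] for [s]; the second is sent by [M]
   to [s] times itself plus [f] times the first. *)
apply/SL2_classP; exists (mx2 ((a - s) / f) 1 (-1) 0).
  by rewrite /SL2 /= det_mx2; ring.
by rewrite !mul_mx2 bE dE; congr mx2; field.
Qed.

Lemma sqclass_eqP (a b : k) :
  sqclass a = sqclass b <-> exists2 r, r != 0 & a = b * r ^+ 2.
Proof.
split=> [e|[r r0 ->]].
  have : sqclass a a by exists 1; rewrite /= ?oner_neq0 // expr1n mulr1.
  by rewrite e => -[r r0 <-]; exists r.
apply/seteqP; split=> _ [c /= c0 <-].
  by exists (r * c); rewrite /= ?mulf_neq0 // exprMn mulrA.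
exists (c / r); first by rewrite /= mulf_neq0 ?invr_eq0.
by rewrite -mulrA -exprMn (mulrC r) divfK.
Qed.

Lemma mem_regular_class g M : u_le2 k -> \det g = 1 -> \tr g ^+ 2 != 4 ->
  SL2_class g M <-> \det M = 1 /\ \tr M = \tr g.
Proof. by move=> hu g1 gt; rewrite SL2_class_regular. Qed.

(** A scalar product would make [A] upper triangular with both diagonal entries [s], so of squared
    trace 4. *)
Lemma class_mul_unipotent_scalar g (e s : k) :
  s ^+ 2 = 1 -> \tr g ^+ 2 != 4 ->
  ~ class_mul (SL2_class g) (unipotent_class e) s%:M.
Proof.
move=> s2 gt /class_mulP [h [A [hS /SL2_class_det_tr [_ At]]]].
rewrite -scalar_mxC => /(can_inj (mulKmx (SL2_unitmx hS))).
rewrite mul_shear scalar_mx2 => e2; have [sA _ A0 sd] := mx2_inj e2.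
rewrite -A0 mulr0 add0r in sd.
case/eqP: gt; rewrite -At [A]mx2_eta mxtrace_mx2 -sA -sd.
by transitivity (4 * s ^+ 2); [ring|rewrite s2 mulr1].
Qed.

(** The lower left entry is forced by the trace of the product. It is nonzero, so with upper left
    entry 0 the determinant can be fixed by the upper right one. *)
Lemma exists_trace_shift (e t t' : k) : e != 0 -> t' != t ->
  exists A, [/\ \det A = 1, \tr A = t, A 1 0 = (t' - t) / e,
    \det (A *m (1%:M + e *: delta_mx 0 1)) = 1 &
    \tr (A *m (1%:M + e *: delta_mx 0 1)) = t'].
Proof.
move=> e0 tt'; have d0 : t' - t != 0 by rewrite subr_eq0.
exists (mx2 0 (- (e / (t' - t))) ((t' - t) / e) t).
rewrite mul_shear !mxE /= !det_mx2 !mxtrace_mx2.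
by split=> //; field; rewrite ?e0 ?d0.
Qed.

(** Taking [s = 1] and [s = -1] treats unipotent and negative unipotent classes together. Both
    directions compare [s + s = tr g + e c] with [c = - e1 r^2], where [c] is the lower left entry
    of [A]. *)
Lemma shear_sub_class_mul g (s e e1 : k) : u_le2 k ->
  \det g = 1 -> \tr g ^+ 2 != 4 -> s ^+ 2 = 1 -> e != 0 -> e1 != 0 ->
  SL2_class (s%:M + e1 *: delta_mx 0 1)
    `<=` class_mul (SL2_class g) (unipotent_class e) <->
  sqclass (\tr g - (s + s)) = sqclass (e * e1).
Proof.
move=> hu g1 gt s2 e0 e10.
have ts : s + s != \tr g.
  by apply: contraNneq gt => <-; apply/eqP;
    transitivity (4 * s ^+ 2); [ring|rewrite s2 mulr1].
rewrite sqclass_eqP sub_class_mulP; split=> [[A cA cAu]|[r r0 tr]].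
  have [_ At] := SL2_class_det_tr cA.
  have [r] := shear_class_entry cAu.
  have [_] := SL2_class_det_tr cAu.
  rewrite mul_shear shear_mx2 !mxtrace_mx2 mxE /= => tAu cr.
  have tE : \tr g - (s + s) = e * e1 * r ^+ 2.
    by rewrite -tAu cr -At [A in \tr A]mx2_eta mxtrace_mx2; ring.
  exists r => //; apply: contraNneq ts => r0.
  by rewrite eq_sym -subr_eq0 tE r0 expr0n mulr0.
have [A [A1 At Ac Au1 Aut]] := exists_trace_shift e0 ts.
exists A; first by apply/mem_regular_class.
apply: (shear_class_mem e10 r0) => //; first by rewrite Au1.
rewrite mul_shear mxE /= Ac -opprB tr; field.
by rewrite e0.
Qed.

End Field.

Theorem proposition3p21 (k : fieldType)
    (hu : u_le2 k)
    (hqc : ~ quadratically_closed k)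
    (hchar : 2%N \notin [pchar k])
    (hcard : exists s : seq k, uniq s /\ (5 <= size s)%N)
    (eps : k) (heps : eps != 0)
    (C : set 'M[k]_2) (hC : semisimple_class C) :
  (~ class_mul C (unipotent_class eps) 1%:M /\
   ~ class_mul C (unipotent_class eps) (- 1%:M)) /\
  (C `<=` class_mul C (unipotent_class eps) <-> split_semisimple_class C) /\
  (forall C' : set 'M[k]_2, semisimple_class C' -> C' <> C ->
     C' `<=` class_mul C (unipotent_class eps)) /\
  (forall eps1 : k, eps1 != 0 ->
     (unipotent_class eps1 `<=` class_mul C (unipotent_class eps) <->
      sqclass (class_trace C - 2) = sqclass (eps * eps1))) /\
  (forall eps1 : k, eps1 != 0 ->
     (neg_unipotent_class eps1 `<=` class_mul C (unipotent_class eps) <->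
      sqclass (class_trace C + 2) = sqclass (eps * eps1))).
Proof.
have [g [g1 gc gs CE]] := hC; have gt := semisimple_noncentral_tr g1 gc gs.
have memC M := mem_regular_class M hu g1 gt.
have -> : class_trace C = \tr g by rewrite CE class_traceE.
split; [|split; [|split; [|split]]].
- rewrite CE; split.
    by apply: class_mul_unipotent_scalar => //; rewrite expr1n.
  rewrite -rmorphN.
  by apply: class_mul_unipotent_scalar => //; rewrite sqrrN expr1n.
- split=> [sub|[_ diag]].
    split=> // M; move: sub.
    rewrite CE => /sub_class_mulP [A cA cAu] /memC [M1 Mt].
    have [A1 At] := (memC A).1 cA; have [_ Aut] := SL2_class_det_tr cAu.
    (* Both [A] and its product with the shear have trace [\tr g], and these traces differ by
       [eps * A 1 0]. *)
    have A10 : A 1 0 = 0.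
      apply: (mulfI heps); rewrite mulr0; apply: (addrI (\tr A)).
      by rewrite addr0 At -[in RHS]Aut mul_shear -At [A in \tr A]mx2_eta
        !mxtrace_mx2; ring.
    have AD : A = mx2 (A 0 0) (A 0 1) 0 (A 1 1) by rewrite -A10 -mx2_eta.
    (* Dropping the upper right entry keeps trace and determinant, so every [M] in the class is
       conjugate to [D]. *)
    pose D := mx2 (A 0 0) 0 0 (A 1 1).
    have D1 : \det D = 1 by move: A1; rewrite AD !det_mx2 mulr0 mul0r.
    have Dt : \tr D = \tr g by rewrite -At AD !mxtrace_mx2.
    have /SL2_classP [h hS e] : SL2_class D M.
      by apply/(mem_regular_class M hu D1); rewrite Dt.
    have hu' := SL2_unitmx hS; apply/diagonalizable_mx2P.
    exists (invmx h), (A 0 0), (A 1 1); rewrite unitmx_inv; split=> //.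
    by apply: (can_inj (mulKmx hu')); rewrite mulKVmx // mulmxA -e mulmxK.
  have /diagonalizable_mx2P [P [x [y [Pu e]]]] : diagonalizable g.
    by apply: diag; rewrite CE; exact: SL2_class_refl.
  have [] := unit_conj_det_tr Pu e; rewrite g1 det_mx2 mulr0 subr0 => xy1 xyt.
  (* The shear changes only the upper right entry of a diagonal matrix, which therefore stays in the
     class. *)
  rewrite CE; apply/sub_class_mulP; exists (mx2 x 0 0 y).
    by apply/memC; rewrite det_mx2 mulr0 subr0.
  apply/memC; rewrite mul_shear det_mx2 mxtrace_mx2 !mxE /= xy1 xyt.
  by rewrite mxtrace_mx2; split; ring.
- move=> C' [g' [g'1 g'c g's C'E]]; rewrite C'E CE => neq.
  have g't := semisimple_noncentral_tr g'1 g'c g's.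
  (* Distinct semisimple classes have distinct traces. *)
  have tt' : \tr g' != \tr g.
    by apply/eqP => tE; apply: neq; rewrite !SL2_class_regular // tE.
  have [A [A1 At _ Au1 Aut]] := exists_trace_shift heps tt'.
  apply/sub_class_mulP; exists A; first by apply/memC.
  by apply/mem_regular_class.
- move=> e1 e10; rewrite CE.
  by apply: shear_sub_class_mul => //; rewrite expr1n.
- move=> e1 e10; rewrite CE (_ : 2 = - (-1 + -1)); last by ring.
  by apply: shear_sub_class_mul => //; rewrite sqrrN expr1n.
Qed.
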